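(* Let $n\ge1$ and let $A_n$ be the area (number of cells) of a uniformly random Ferrers diagram with semiperimeter $n+2$. Then $A_n-n-1$ has probability generating function $2^{-n}\sum_{k=0}^n\binom{n}{k}_q$, i.e. $A_n-n-1$ has the same distribution as $G_{n,2}$.
   Context: A Ferrers diagram is a finite nonempty left-justified arrangement of unit cells in rows whose lengths are weakly decreasing from the bottom row upward (all rows nonempty); its height is its number of rows, its width is the length of its longest row, and its semiperimeter is height plus width. $[\ell]_q=(1-q^\ell)/(1-q)$, $[k]!_q=[1]_q\cdots[k]_q$, $[0]!_q=1$, $\binom{n}{k}_q=\frac{[n]!_q}{[k]!_q[n-k]!_q}$. $G_{n,2}$ denotes a random variable with probability generating function $2^{-n}\sum_{k=0}^n\binom nk_q$. *)

(* Defs.v *)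
From HB Require Import structures.
From mathcomp Require Import all_boot all_order all_algebra.
From mathcomp Require Import all_classical all_reals all_analysis.

Set Implicit Arguments.
Unset Strict Implicit.
Unset Printing Implicit Defensive.

Import Order.TTheory GRing.Theory Num.Theory.

Local Open Scope classical_set_scope.
Local Open Scope ring_scope.

(* A Ferrers diagram is encoded by its row lengths, listed from the bottom row
   upward. *)
Definition is_ferrers (s : seq nat) : bool :=
  [&& s != [::], sorted geq s & all (fun r => 0 < r)%N s].

Definition height (s : seq nat) : nat := size s.
Definition width (s : seq nat) : nat := (\max_(r <- s) r)%N.
Definition semiperimeter (s : seq nat) : nat := (height s + width s)%N.

Record ferrers (m : nat) := Ferrers {
  rows :> seq nat;
  _ : is_ferrers rows && (semiperimeter rows == m) }.

HB.instance Definition _ m := [isSub for @rows m].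
HB.instance Definition _ m := [Countable of ferrers m by <:].

Definition area (m : nat) (d : ferrers m) : nat := sumn d.

(* Finiteness of [ferrers m]: both the number of rows and the row lengths are
   at most [m]. *)
Section FerrersFinite.
Variable m : nat.

Lemma size_ferrers (d : ferrers m) :
  (size [seq (inord r : 'I_m.+1) | r <- d] <= m)%N.
Proof.
by rewrite size_map; case: d => s /= /andP[_ /eqP<-]; rewrite leq_addr.
Qed.

Lemma ferrers_row_le (d : ferrers m) r : r \in rows d -> (r <= m)%N.
Proof.
case: d => s /= /andP[_ /eqP<-] rs; apply: leq_trans (leq_addl _ _).
exact: (@leq_bigmax_seq _ s xpredT id r rs isT).
Qed.

Definition ferrers_code (d : ferrers m) : {bseq m of 'I_m.+1} :=
  Bseq (size_ferrers d).

Definition ferrers_decode (b : {bseq m of 'I_m.+1}) : option (ferrers m) :=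
  insub [seq val i | i <- b].

Lemma ferrers_codeK : pcancel ferrers_code ferrers_decode.
Proof.
move=> d; rewrite /ferrers_decode /= -map_comp.
suff -> : [seq (val \o (inord : nat -> 'I_m.+1)) i | i <- d] = rows d.
  exact: valK.
by apply: map_id_in => r rd /=; rewrite inordK // ltnS (ferrers_row_le rd).
Qed.

HB.instance Definition _ :=
  fintype.isFinite.Build (ferrers m) (pcan_enumP ferrers_codeK).

End FerrersFinite.

Section QBinomial.
Variable F : fieldType.

(* q is the polynomial variable. The divisions below are exact: see [qintE]
   and [qbinomE]. *)
Definition qint (l : nat) : {poly F} := (1 - 'X^l) %/ (1 - 'X).
Definition qfact (k : nat) : {poly F} := \prod_(1 <= l < k.+1) qint l.
Definition qbinom (n k : nat) : {poly F} :=
  qfact n %/ (qfact k * qfact (n - k)).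

Lemma oneBX_neq0 l : (0 < l)%N -> 1 - 'X^l != 0 :> {poly F}.
Proof.
move=> l0; rewrite -oppr_eq0 opprB; apply: monic_neq0.
by rewrite -(polyC1 F) monicXnsubC.
Qed.

Lemma qintE l : qint l * (1 - 'X) = 1 - 'X^l.
Proof.
apply: divpK; apply/dvdpP; exists (\sum_(i < l) 'X^i).
by rewrite -[1 - 'X^l]opprB subrX1 -mulNr opprB mulrC.
Qed.

Lemma qint_neq0 l : (0 < l)%N -> qint l != 0.
Proof.
move=> l0; apply/eqP => ql0; have /eqP := qintE l.
by rewrite ql0 mul0r eq_sym (negPf (oneBX_neq0 l0)).
Qed.

Lemma qfact_neq0 k : qfact k != 0.
Proof.
rewrite /qfact big_nat prodf_seq_neq0; apply/allP => l _.
by apply/implyP => /andP[l0 _]; exact: qint_neq0.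
Qed.

Lemma qfactS k : qfact k.+1 = qfact k * qint k.+1.
Proof. by rewrite /qfact big_nat_recr. Qed.

Lemma qintD a b : qint (a + b) = qint a + 'X^a * qint b.
Proof.
apply: (mulIf (oneBX_neq0 (ltnSn 0))); rewrite expr1 mulrDl -mulrA !qintE.
by rewrite exprD mulrBr mulr1 addrA subrK.
Qed.

Lemma qfact_dvd n k : (k <= n)%N -> qfact k * qfact (n - k) %| qfact n.
Proof.
have qfact0 : qfact 0 = 1 by rewrite /qfact big_geq.
elim: n k => [|n IHn] [|k] kn //; rewrite ?subn0 ?qfact0 ?mul1r //.
rewrite subSS; move: kn; rewrite ltnS leq_eqVlt => /orP[/eqP->|kn].
  by rewrite subnn qfact0 mulr1.
rewrite [qfact n.+1]qfactS -[in qint _](subnKC (leqW kn : k.+1 <= n.+1)%N).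
rewrite qintD subSS mulrDr; apply: dvdp_add.
  by rewrite qfactS mulrAC dvdp_mul2r ?qint_neq0 //; exact: IHn _ (ltnW kn).
rewrite -(subnSK kn) [qfact (n - _).+1]qfactS [qfact n * _]mulrCA dvdp_mull //.
rewrite mulrA dvdp_mul2r ?qint_neq0 ?subn_gt0 //; exact: IHn.
Qed.

Lemma qbinomE n k : (k <= n)%N ->
  qbinom n k * (qfact k * qfact (n - k)) = qfact n.
Proof. by move=> kn; apply: divpK; exact: qfact_dvd. Qed.

End QBinomial.

Section Laws.
Context (R : realType) (d : measure_display) (T : measurableType d).

Definition uniformly_distributed (P : probability T R) (K : finType)
    (F : T -> K) : Prop :=
  forall x : K, measurable (F @^-1` [set x]) /\
    P (F @^-1` [set x]) = ((#|K|%:R)^-1)%:E.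

(* [g] is a polynomial because only finitely supported laws are considered;
   [q ^ X t] is an integer power, which is the natural one as [X] is
   nonnegative (in particular 0 ^ 0 = 1). *)
Definition has_pgf (P : probability T R) (X : T -> int) (g : {poly R}) : Prop :=
  (forall t, 0 <= X t) /\
  forall q : R, `|q| <= 1 -> ('E_P[fun t => q ^ X t])%E = (g.[q])%:E :> \bar R.

End Laws.

(* [int] is taken with the discrete sigma-algebra. *)
Definition same_distribution (R : realType)
    (d : measure_display) (T : measurableType d) (P : probability T R)
    (d' : measure_display) (T' : measurableType d') (P' : probability T' R)
    (X : T -> int) (Y : T' -> int) : Prop :=
  forall B : set int, P (X @^-1` B) = P' (Y @^-1` B).

Definition pgf_G2 (R : realType) (n : nat) : {poly R} :=
  (2 ^- n) *: \sum_(0 <= k < n.+1) qbinom R n k.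

(* Main.v *)
(* Every Ferrers diagram other than a single cell arises in exactly one way from
   a diagram of semiperimeter one less, either by repeating the bottom row or by
   adding a cell to it. In the first case the area grows by the width, in the
   second by 1, so the generating function of the area of the diagrams of width
   k + 1 and semiperimeter n + 2 satisfies the q-Pascal recurrence and equals
   X^(n+1) * qbinom n k.
   A probability generating function that agrees with a polynomial g on (0, 1]
   determines the law: the partial sum of order m of E[q^N] differs from g(q) by
   at most q^(m+1), which forces P(N = m) to be the m-th coefficient of g. *)
Require Import Defs.
From mathcomp Require Import all_boot all_order all_algebra.
From mathcomp Require Import all_classical all_reals all_analysis.
From mathcomp Require Import measurable_realfun zify ring.

Set Implicit Arguments.
Unset Strict Implicit.
Unset Printing Implicit Defensive.

Import Order.TTheory GRing.Theory Num.Theory.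

Local Open Scope ring_scope.

(** * q-binomial coefficients and the q-Pascal recurrence *)

Section Pascal.
Variable F : fieldType.

Lemma qfact0 : qfact F 0 = 1.
Proof. by rewrite /qfact big_geq. Qed.

Lemma qbinom0 n : qbinom F n 0 = 1.
Proof. by rewrite /qbinom qfact0 mul1r subn0 divpp ?qfact_neq0. Qed.

Lemma qbinomn n : qbinom F n n = 1.
Proof. by rewrite /qbinom subnn qfact0 mulr1 divpp ?qfact_neq0. Qed.

(** After multiplication by [qfact F k.+1 * qfact F (n - k)] this is the splitting of the q-integer
    [n+1] as [k+1] + X^(k+1) [n-k], given by [qintD]. *)
Lemma qbinomS n k : (k < n)%N ->
  qbinom F n.+1 k.+1 = qbinom F n k + 'X^(k.+1) * qbinom F n k.+1.
Proof.
move=> kn; have nk : qfact F k.+1 * qfact F (n - k) != 0.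
  by rewrite mulf_neq0 ?qfact_neq0.
have dk := qbinomE F (ltnW kn); have dk1 := qbinomE F kn.
have dS := qbinomE F (leqW kn); rewrite subSS in dS.
apply: (mulIf nk); rewrite dS mulrDl qfactS.
rewrite -[in qint F n.+1](subnKC (leqW kn : k.+1 <= n.+1)%N) qintD subSS mulrDr.
congr (_ + _); first by rewrite -dk qfactS; ring.
by rewrite -dk1 -(subnSK kn) [qfact F (n - k.+1).+1]qfactS; ring.
Qed.

End Pascal.

(** * Enumeration of the diagrams by growing the bottom row *)

Section Diagrams.
Local Open Scope nat_scope.

Definition dup_bottom (s : seq nat) := head 0 s :: s.
Definition widen_bottom (s : seq nat) := (head 0 s).+1 :: behead s.

(** An explicit list in place of the finite type [ferrers (n + 2)], so that sums over diagrams can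
    be computed by induction on [n]. *)
Fixpoint diagrams n : seq (seq nat) :=
  if n is m.+1 then
    [seq dup_bottom s | s <- diagrams m] ++
    [seq widen_bottom s | s <- diagrams m]
  else [:: [:: 1]].

Lemma size_diagrams n : size (diagrams n) = 2 ^ n.
Proof.
by elim: n => //= n IHn; rewrite size_cat !size_map IHn addnn -mul2n expnS.
Qed.

Lemma width_ferrers s : is_ferrers s -> width s = head 0 s.
Proof.
case: s => [//|r s] /and3P[_ rs _]; rewrite /width big_cons /=.
apply/maxn_idPl/bigmax_leqP_seq => i si _.
have /= /andP[/allP + _] : pairwise geq (r :: s).
  by rewrite -sorted_pairwise// => x y z /= xy yz; exact: leq_trans yz xy.
exact.
Qed.

Lemma ferrers_dup r s :
  is_ferrers (r :: r :: s) = is_ferrers (r :: s).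
Proof. by rewrite /is_ferrers /= leqnn; case: (0 < r). Qed.

Lemma ferrers_widen r s : is_ferrers (r :: s) -> is_ferrers (r.+1 :: s).
Proof.
rewrite /is_ferrers; case: s => [|x s] //= /and4P[/andP[xr -> _]].
by rewrite leqW // => -> ->.
Qed.

Lemma mem_diagrams n s :
  (s \in diagrams n) = is_ferrers s && (semiperimeter s == n + 2).
Proof.
elim: n s => [|n IHn] s.
  rewrite /= inE; apply/eqP/andP => [->|[fs]].
    by rewrite /semiperimeter /width big_seq1.
  rewrite /semiperimeter width_ferrers//.
  case: s fs => [|[|r] [|y s]] //; rewrite /is_ferrers /height /= ?andbF//.
    by case: r.
  by move=> _ /eqP; lia.
rewrite /= mem_cat; apply/orP/andP.
- case=> /mapP[[|r t]]; rewrite IHn => /andP[] // ft st -> /=.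
    split; first by rewrite ferrers_dup.
    move: st; rewrite /semiperimeter !width_ferrers ?ferrers_dup//=.
  have f' : is_ferrers (r.+1 :: t) by exact: ferrers_widen.
  split=> //.
  move: st; rewrite /semiperimeter !width_ferrers//= /height/=; lia.
- case=> fs; rewrite /semiperimeter width_ferrers// /height.
  case: s fs => [//|r s] fs /= ss.
  (* The predecessor is read off the two lowest rows: if they are equal, the bottom one is deleted;
     otherwise it loses a cell. *)
  have [/andP[hs s0]|hs] := boolP ((head 0 s == r) && (s != [::])).
    left; apply/mapP; exists s; last by rewrite /dup_bottom (eqP hs).
    case: s s0 hs fs ss => // x s _ /= /eqP -> + /=.
    rewrite ferrers_dup => fs ss.
    by rewrite IHn fs /semiperimeter width_ferrers// /height /=.
  right; apply/mapP; exists (r.-1 :: s); last first.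
    move: fs; rewrite /is_ferrers /widen_bottom /=.
    by case: r {ss hs} => //=; rewrite andbF.
  (* A bottom row strictly longer than the next one can be shortened; a lone row has length n + 2,
     so shortening leaves it nonempty. *)
  have f' : is_ferrers (r.-1 :: s).
    move: fs hs ss; rewrite /is_ferrers; case: s => [|x s] /=; first lia.
    case: (path geq x s) => /=; rewrite ?andbF //.
    by case: (all _ s) => /=; rewrite ?andbF //; lia.
  rewrite IHn f' /semiperimeter width_ferrers// /height /=.
  by move: fs; rewrite /is_ferrers /=; lia.
Qed.

(** Both growth maps are injective on diagrams. Their images are disjoint: duplication makes the two
    lowest rows equal, whereas a widened bottom row is strictly longer than any row above it. *)
Lemma diagrams_uniq n : uniq (diagrams n).
Proof.
elim: n => //= n IHn; rewrite cat_uniq !map_inj_in_uniq ?IHn ?andbT //=.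
- apply/hasPn => s /mapP[t tn ->]; apply/negP => /mapP[u un []].
  move: tn un; rewrite !mem_diagrams /is_ferrers.
  case: t => [//|r [|x t]]; case: u => [|y u] //=.
  move=> /andP[/and3P[rx _ _] _] _ ry tu.
  case: tu => xy _; move: rx ry; lia.
- move=> s t; rewrite !mem_diagrams.
  case: s => [//|x s]; case: t => [//|y t] _ _.
  by case=> -> ->.
- by move=> s t _ _ [].
Qed.

Lemma head_diagrams n s : s \in diagrams n -> 0 < head 0 s <= n.+1.
Proof.
rewrite mem_diagrams => /andP[fs].
rewrite /semiperimeter width_ferrers// /height.
by case: s fs => [//|r s]; rewrite /is_ferrers /= => fs ?; lia.
Qed.

(** Each growth step adds at least one cell. Hence the truncated subtraction [sumn s - n.+1] used
    below is a true difference. *)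
Lemma sumn_diagrams n s : s \in diagrams n -> n < sumn s.
Proof.
elim: n s => [|n IHn] s /=; first by rewrite inE => /eqP->.
rewrite mem_cat => /orP[] /mapP[t tn ->];
  have := IHn _ tn; have := head_diagrams tn.
  by rewrite /=; lia.
by case: t {tn} => //= r t; lia.
Qed.

End Diagrams.

Lemma sum_ferrers (V : nmodType) n (f : seq nat -> V) :
  \sum_(x : ferrers (n + 2)) f x = \sum_(s <- diagrams n) f s.
Proof.
rewrite -(big_map (@rows (n + 2)) xpredT) -[LHS]/(\sum_(s <- _) f s).
apply: perm_big; apply: uniq_perm; rewrite ?diagrams_uniq//.
  by rewrite map_inj_uniq ?index_enum_uniq//; exact: val_inj.
move=> s; rewrite mem_diagrams; apply/mapP/idP => [[x _ ->]|sf].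
  by case: x.
by exists (Ferrers sf); rewrite ?mem_index_enum.
Qed.

Lemma card_ferrers n : #|{: ferrers (n + 2)}| = (2 ^ n)%N.
Proof.
by rewrite -sum1_card (sum_ferrers n (fun=> 1%N)) sum1_size size_diagrams.
Qed.

(** * The area generating function *)

Section GeneratingFunction.
Variable F : fieldType.

Lemma sum_diagrams_width n k : (k <= n)%N ->
  \sum_(s <- diagrams n | head 0%N s == k.+1) 'X^(sumn s)
    = 'X^(n.+1) * qbinom F n k.
Proof.
pose S n k : {poly F} := \sum_(s <- diagrams n | head 0%N s == k) 'X^(sumn s).
have S0 m : S m 0%N = 0.
  rewrite /S big_seq_cond big1 // => s /andP[/head_diagrams + /eqP]; lia.
(* Duplication keeps the width j + 1 and adds that many cells; widening passes from width j to j + 1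
   and adds one cell. *)
have SS m j : S m.+1 j.+1 = 'X^(j.+1) * S m j.+1 + 'X * S m j.
  rewrite /S big_cat !big_map; congr (_ + _).
    rewrite mulr_sumr; apply: eq_big => // s /eqP /= ->; exact: exprD.
  rewrite mulr_sumr big_seq_cond [RHS]big_seq_cond.
  apply: eq_big => [s|s /andP[sm _]].
    by rewrite /= eqSS.
  by case: s sm => [|r s] /=; rewrite ?mem_diagrams// addSn exprS.
have Sbig m : S m m.+2 = 0.
  rewrite /S big_seq_cond big1 // => s /andP[/head_diagrams + /eqP]; lia.
rewrite -/(S _ _); elim: n k => [|n IHn] [|k] kn //.
- by rewrite /S big_mkcond big_seq1 /= qbinom0 mulr1.
- by rewrite SS S0 mulr0 addr0 IHn// !qbinom0 !mulr1 -exprS.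
(* At the maximal width the diagram is a single row, which arises only by widening; elsewhere both
   terms contribute and [qbinomS] applies. *)
- rewrite SS; move: kn; rewrite ltnS leq_eqVlt => /orP[/eqP->|kn].
    by rewrite Sbig mulr0 add0r IHn// !qbinomn !mulr1 -exprS.
  by rewrite (IHn _ kn) (IHn _ (ltnW kn)) qbinomS// !exprS; ring.
Qed.

Lemma sum_diagrams n :
  \sum_(s <- diagrams n) 'X^(sumn s - n.+1)
    = \sum_(0 <= k < n.+1) qbinom F n k.
Proof.
have X0 : 'X^(n.+1) != 0 :> {poly F} by rewrite monic_neq0 ?monicXn.
apply: (mulfI X0); rewrite !mulr_sumr big_mkord.
(* After multiplication by X^(n+1) the right side is a sum over widths; exchanging the sums leaves,
   for each diagram, the single index k equal to its width minus 1. *)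
under [RHS]eq_bigr => k _ do rewrite -sum_diagrams_width -1?ltnS ?ltn_ord//.
rewrite (exchange_big_dep xpredT)//= big_seq [RHS]big_seq.
apply: eq_bigr => s sn; have /andP[h0 hn] := head_diagrams sn.
have hk : ((head 0 s).-1 < n.+1)%N by lia.
rewrite (big_pred1 (Ordinal hk)) => [|k].
  by rewrite -exprD subnKC// sumn_diagrams.
by rewrite /= -val_eqE /=; lia.
Qed.

End GeneratingFunction.

(** * Coefficients of a polynomial that is small near 0 *)

Lemma horner_drop1 (R : comNzRingType) (h : {poly R}) (q : R) :
  h.[q] = h`_0 + (drop_poly 1 h).[q] * q.
Proof.
rewrite -{1}[h](poly_take_drop 1) hornerD hornerM hornerXn expr1.
by rewrite horner_poly big_ord1 expr0 mulr1.
Qed.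

Lemma coef0_eq0_le_linear (R : realFieldType) (h : {poly R}) (C : R) :
  (forall q : R, 0 < q <= 1 -> `|h.[q]| <= C * q) -> h`_0 = 0.
Proof.
move=> hle; have [C' C'le] := poly_disk_bound (drop_poly 1 h) 1.
pose D := `|C + C'| + 1.
have D0 : 0 < D by rewrite ltr_wpDl.
have bound q : 0 < q <= 1 -> `|h`_0| <= D * q.
  move=> q01; have /andP[q0 q1] := q01.
  have -> : h`_0 = h.[q] - (drop_poly 1 h).[q] * q.
    by rewrite horner_drop1 addrK.
  apply: le_trans (ler_normB _ _) _; rewrite normrM (gtr0_norm q0).
  apply: (@le_trans _ _ ((C + C') * q)).
    by rewrite mulrDl lerD ?hle// ler_pM2r// C'le// gtr0_norm.
  by rewrite ler_pM2r// /D (le_trans (ler_norm _))// lerDl.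
apply/eqP; rewrite -normr_eq0 eq_le normr_ge0 andbT leNgt; apply/negP => h0.
have hD : 0 < `|h`_0| + D by rewrite addr_gt0.
have /bound : 0 < `|h`_0| / (`|h`_0| + D) <= 1.
  by rewrite divr_gt0// ler_pdivrMr// mul1r lerDl ltW.
by rewrite mulrA ler_pdivlMr// mulrC ler_pM2r// leNgt ltrDr h0.
Qed.

(** Since q^(m+1) is at most q on (0, 1], the constant coefficient vanishes; dividing [h] by q then
    lowers the exponent by one. *)
Lemma coef_eq0_le_pow (R : realFieldType) (h : {poly R}) (C : R) (m : nat) :
  (forall q : R, 0 < q <= 1 -> `|h.[q]| <= C * q ^+ m.+1) -> h`_m = 0.
Proof.
elim: m h C => [|m IHm] h C hle; first exact: coef0_eq0_le_linear hle.
have h0 : h`_0 = 0.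
  apply: (@coef0_eq0_le_linear _ h `|C|) => q q01.
  apply: le_trans (hle q q01) _.
  case/andP: q01 => q0 q1; rewrite exprSr mulrA ler_pM2r//.
  rewrite (le_trans (ler_norm _))// normrM ler_piMr// normrX gtr0_norm//.
  by rewrite exprn_ile1// ltW.
suff : (drop_poly 1 h)`_m = 0 by rewrite coef_drop_poly addn1.
apply: (IHm _ C) => q q01; have := hle q q01; case/andP: q01 => q0 q1.
by rewrite horner_drop1 h0 add0r normrM (gtr0_norm q0) exprSr mulrA ler_pM2r.
Qed.

(** * Expectations and the coefficients of a generating function *)

Section Expectation.
Context (R : realType) (d : measure_display) (T : measurableType d).
Context (P : probability T R).
Local Open Scope classical_set_scope.
Local Open Scope ereal_scope.

(** [K] carries no sigma-algebra, so measurability comes from the finitely many fibres of [F]. *)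
Lemma uniformly_distributed_preimage (K : finType) (F : T -> K) (A : set K) :
  uniformly_distributed P F -> measurable (F @^-1` A).
Proof.
move=> hF; have -> : F @^-1` A = \bigcup_(x in A) F @^-1` [set x].
  by apply/seteqP; split=> [t At|t [x Ax /= ->]] //; exists (F t).
apply: fin_bigcup_measurable => [|x _]; first exact: finite_finset.
by have [] := hF x.
Qed.

Lemma expectation_uniform (K : finType) (F : T -> K) (f : K -> R) :
  uniformly_distributed P F ->
  'E_P[f \o F] = (#|K|%:R^-1 * \sum_x f x)%:E.
Proof.
move=> hF; rewrite unlock.
have covT : \big[setU/set0]_(x <- index_enum K) (F @^-1` [set x]) = setT.
  apply/seteqP; split=> // t _; rewrite -bigcup_seq.
  by exists (F t) => //=; rewrite mem_index_enum.
have mf : measurable_fun setT (EFin \o (f \o F)).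
  move=> _ Y _; rewrite setTI.
  exact: (uniformly_distributed_preimage (f @^-1` (EFin @^-1` Y)) hF).
rewrite -[setT in LHS]covT integral_bigsetU_EFin ?index_enum_uniq//.
- transitivity (\sum_x (#|K|%:R^-1 * f x)%:E); last first.
    by rewrite sumEFin mulr_sumr.
  apply: eq_bigr => x _; have [mx Px] := hF x.
  transitivity (\int[P]_(t in F @^-1` [set x]) (cst (f x)%:E t)).
    by apply: eq_integral => t; rewrite inE/= => ->.
  by rewrite integral_cst// mulrC EFinM; congr (_ * _).
- by move=> x; have [] := hF x.
- by move=> x y _ _ [t [/= <- <-]].
- by rewrite covT.
Qed.

(** The remainder [r] is the integral over N > m, where q^N is at most q^(m+1) and the total mass is
    at most 1. *)
Lemma expectation_pow_tail (N : T -> nat) (m : nat) (q : R) :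
  measurable_fun setT N -> (0 <= q <= 1)%R ->
  exists2 r : R, (0 <= r <= q ^+ m.+1)%R &
    'E_P[(fun t => q ^+ N t)%R] =
      (\sum_(k < m.+1) fine (P (N @^-1` [set (k : nat)])) * q ^+ k + r)%:E.
Proof.
move=> mN /andP[q0 q1]; rewrite unlock.
have mA A : measurable (N @^-1` A) by rewrite -[_ @^-1` _]setTI; exact: mN.
have mf D : measurable D -> measurable_fun D (EFin \o (fun t => (q ^+ N t)%R)).
  move=> mD; apply/measurable_EFinP; apply: (measurable_funTS).
  by move=> _ Y _; rewrite setTI; exact: (mA (GRing.exp q @^-1` Y)).
pose D := N @^-1` [set k | (k <= m)%N].
have mD : measurable D by exact: mA.
have -> : setT = D `|` ~` D by rewrite setUv.
rewrite ge0_integral_setU; first last.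
- by rewrite disj_set2E setICr.
- by move=> t _; rewrite lee_fin exprn_ge0.
- by rewrite setUv; exact: mf.
- exact: measurableC.
- by [].
have DE : D = \big[setU/set0]_(k < m.+1) (N @^-1` [set (k : nat)]).
  rewrite -bigcup_seq; apply/seteqP; split=> [t /= Nt|t [k _ /= Nt]].
    by exists (Ordinal (Nt : N t < m.+1)%N) => //=; rewrite mem_index_enum.
  by rewrite /D /= Nt -ltnS.
have Dint : \int[P]_(t in D) (q ^+ N t)%:E =
    (\sum_(k < m.+1) fine (P (N @^-1` [set (k : nat)])) * q ^+ k)%:E.
  rewrite DE integral_bigsetU_EFin ?index_enum_uniq//; last 2 first.
  - move=> x y _ _ [t [/= Nx Ny]].
    by apply: val_inj; exact: etrans (esym Nx) Ny.
  - by apply: mf; rewrite -DE.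
  rewrite -sumEFin; apply: eq_bigr => k _.
  transitivity (\int[P]_(t in N @^-1` [set (k : nat)]) (cst (q ^+ k)%:E t)).
    by apply: eq_integral => t; rewrite inE/= => ->.
  by rewrite integral_cst// EFinM fineK ?fin_num_measure// muleC.
set J := \int[P]_(t in ~` D) _.
have J0 : 0 <= J by apply: integral_ge0 => t _; rewrite lee_fin exprn_ge0.
have J1 : J <= (q ^+ m.+1)%:E.
  apply: (@le_trans _ _ (\int[P]_(t in ~` D) (cst (q ^+ m.+1)%:E t))).
    apply: ge0_le_integral => //.
    - exact: measurableC.
    - by move=> t _; rewrite lee_fin exprn_ge0.
    - by apply: mf; exact: measurableC.
    - move=> t /= /negP; rewrite -ltnNge => mt; rewrite lee_fin.
      exact: ler_wiXn2l.
  rewrite integral_cst; last exact: measurableC.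
  rewrite -[leRHS]mule1; apply: lee_wpmul2l; first by rewrite lee_fin exprn_ge0.
  by apply: probability_le1; exact: measurableC.
have Jfin : J \is a fin_num by rewrite ge0_fin_numE// (le_lt_trans J1)// ltry.
exists (fine J).
  by rewrite fine_ge0//= -lee_fin fineK.
by rewrite Dint EFinD fineK.
Qed.

Lemma pgf_coef (N : T -> nat) (g : {poly R}) (k : nat) :
  measurable_fun setT N -> has_pgf P (fun t => (N t)%:Z) g ->
  P (N @^-1` [set k]) = (g`_k)%:E.
Proof.
move=> mN [_ pgf].
have mA A : measurable (N @^-1` A) by rewrite -[_ @^-1` _]setTI; exact: mN.
(* [p] is the generating polynomial of the law cut off after [k]; on (0, 1] the value of [g - p] is
   the tail [r], whence the constant 1 in the bound. *)
pose p := \poly_(j < k.+1) fine (P (N @^-1` [set j])).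
suff : ((g - p)`_k = 0)%R.
  rewrite coefB coef_poly ltnSn => /eqP; rewrite subr_eq0 => /eqP ->.
  by rewrite fineK ?fin_num_measure.
apply: (@coef_eq0_le_pow _ _ 1) => q /andP[q0 q1].
have q01 : (0 <= q <= 1)%R by rewrite ltW.
have [r /andP[r0 r1] Eq] := expectation_pow_tail k mN q01.
have nq : (`|q| <= 1)%R by rewrite ger0_norm// ltW.
have [gq] := etrans (esym (pgf q nq)) Eq.
by rewrite mul1r hornerD hornerN gq horner_poly addrC addKr ger0_norm.
Qed.

End Expectation.

(** * From coefficients to equality of laws *)

Local Open Scope classical_set_scope.

Lemma measure_preimage_nat (R : realType) (d : measure_display)
    (T : measurableType d) (P : probability T R) (N : T -> nat) (A : set nat) :
  measurable_fun setT N ->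
  P (N @^-1` A) = (\sum_(k <oo | k \in A) P (N @^-1` [set k]))%E.
Proof.
move=> mN; rewrite -measure_bigcup.
- congr (P _); apply/seteqP; split=> [t At|t [k Ak /= Nt]].
    by exists (N t).
  by rewrite /preimage /= Nt.
- by move=> k _; rewrite -[X in measurable X]setTI; exact: mN.
- by move=> x y _ _ [t [/= <- <-]].
Qed.

Lemma same_distribution_pgf (R : realType)
    (d : measure_display) (T : measurableType d) (P : probability T R)
    (d' : measure_display) (T' : measurableType d') (P' : probability T' R)
    (N : T -> nat) (N' : T' -> nat) (g : {poly R}) :
  measurable_fun setT N -> measurable_fun setT N' ->
  has_pgf P (fun t => (N t)%:Z) g -> has_pgf P' (fun t => (N' t)%:Z) g ->
  same_distribution P P' (fun t => (N t)%:Z) (fun t => (N' t)%:Z).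
Proof.
move=> mN mN' pgfN pgfN' B.
(* Only the natural numbers in [B] matter, and countable additivity reduces the claim to point
   masses. *)
transitivity (P (N @^-1` (Posz @^-1` B))); first by [].
transitivity (P' (N' @^-1` (Posz @^-1` B))); last by [].
rewrite !measure_preimage_nat//; apply: eq_eseriesr => k _.
by rewrite (pgf_coef k mN pgfN) (pgf_coef k mN' pgfN').
Qed.

Theorem theorem4p2 (R : realType) (n : nat) (hn : (1 <= n)%N)
    (d : measure_display) (T : measurableType d) (P : probability T R)
    (F : T -> ferrers (n + 2)) (hF : uniformly_distributed P F) :
  let X : T -> int := fun t => (area (F t))%:Z - n%:Z - 1 in
  has_pgf P X (pgf_G2 R n) /\
  forall (d' : measure_display) (T' : measurableType d')
      (P' : probability T' R) (G : {RV P' >-> nat}),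
    has_pgf P' (fun t => (G t)%:Z) (pgf_G2 R n) ->
    same_distribution P P' X (fun t => (G t)%:Z).
Proof.
move=> X.
pose N t := (area (F t) - n.+1)%N.
have XE t : X t = (N t)%:Z.
  have rowsF : rows (F t) \in diagrams n.
    by rewrite mem_diagrams; case: (F t).
  have := sumn_diagrams rowsF; rewrite /X /N /area; lia.
have mN : measurable_fun setT N.
  move=> _ Y _; rewrite setTI.
  pose excess (x : ferrers (n + 2)) := (area x - n.+1)%N.
  exact: (uniformly_distributed_preimage (excess @^-1` Y) hF).
have pgfX : has_pgf P X (pgf_G2 R n).
  split=> [t|q _]; first by rewrite XE.
  (* The expectation becomes an average over the 2^n diagrams, which supplies the factor 2^-n in
     [pgf_G2]. *)
  pose f (x : ferrers (n + 2)) := q ^+ (area x - n.+1).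
  transitivity ('E_P[f \o F])%E.
    by congr expectation; apply/funext => t; rewrite XE.
  rewrite expectation_uniform// card_ferrers /pgf_G2 hornerZ natrX.
  congr (_ * _)%:E.
  rewrite (sum_ferrers n (fun s => q ^+ (sumn s - n.+1))).
  rewrite -sum_diagrams horner_sum.
  by apply: eq_bigr => s _; rewrite hornerXn.
split=> // d' T' P' G pgfG B.
have pgfN : has_pgf P (fun t => (N t)%:Z) (pgf_G2 R n).
  by rewrite -(_ : X = fun t => (N t)%:Z)//; apply/funext.
have -> : X = fun t => (N t)%:Z by apply/funext.
have mG : measurable_fun setT G by exact: measurable_funP.
exact: (same_distribution_pgf mN mG pgfN pgfG).
Qed.
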